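(* Let $p\ge2$, $n\ge 1$, let $x_1,\dots,x_n\in\mathbb R^p$ be fixed vectors, $\mathbb X=(x_1,\dots,x_n)^\top\in\mathbb R^{n\times p}$, and $Y_i=x_i^\top\beta^*+\xi_i$, $i=1,\dots,n$, with $\beta^*\in\mathbb R^p$. Let $\xi_i$ be i.i.d. Gaussian $\mathcal N(0,\sigma^2)$, $\sigma>0$, and let the diagonal elements of the matrix $\frac1n\mathbb X^\top\mathbb X$ be not larger than $1$. Take $$\lambda=C\sigma\sqrt{\frac{\log p}{n}},\qquad C=3b\sqrt2,\quad b\ge1,$$ and let $\hat\beta^\lambda$ be a Lasso estimator, i.e. a minimizer over $\beta\in\mathbb R^p$ of $\frac1n\sum_{i=1}^n(Y_i-x_i^\top\beta)^2+\lambda|\beta|_1$. Then, with probability at least $1-\frac1{p^{b^2-1}\sqrt{\pi\log p}}$, $$\frac1n|\mathbb X(\hat\beta^\lambda-\beta^* )|_2^2\le\inf_{\beta\in\mathbb R^p}\left\{\frac1n|\mathbb X(\beta-\beta^* )|_2^2+C^2\sigma^2\,\frac{\mu^2(\beta)M(\beta)\log p}{n}\right\}.$$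
   Context: $|\cdot|_q$ denotes the $\ell_q$-norm of vectors. $M(\beta)$ is the number of nonzero components of $\beta$. For $u\in\mathbb R^p$ and $J\subseteq\{1,\dots,p\}$, $u_J$ is the vector that coincides with $u$ on $J$ and is zero on the complement $J^c$. For $\beta\in\mathbb R^p$ with $J=\{j:\beta_j\ne0\}$, $$\mu(\beta)=\inf\Big\{\mu'>0:\ |u_J|_2\le\mu'\,\tfrac1{\sqrt n}|\mathbb Xu|_2\ \text{ for all }u\in\mathbb R^p\text{ with }|u_{J^c}|_1\le5|u_J|_1\Big\}$$ (with $\inf\emptyset=+\infty$). *)

(* Defs.v *)
From HB Require Import structures.
From mathcomp Require Import all_boot all_order all_algebra.
From mathcomp Require Import all_classical all_reals all_analysis.

Set Implicit Arguments.
Unset Strict Implicit.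
Unset Printing Implicit Defensive.

Import Order.TTheory GRing.Theory Num.Theory.
Import numFieldNormedType.Exports.

Local Open Scope classical_set_scope.
Local Open Scope ring_scope.

(* The library norm on matrices is the sup norm, hence these definitions. *)
Definition l1norm (R : realType) (m : nat) (u : 'cV[R]_m) : R :=
  \sum_(j < m) `|u j 0|.

Definition l2norm (R : realType) (m : nat) (u : 'cV[R]_m) : R :=
  Num.sqrt (\sum_(j < m) u j 0 ^+ 2).

Definition vsupp (R : realType) (p : nat) (beta : 'cV[R]_p) : {set 'I_p} :=
  [set j | beta j 0 != 0]%SET.

Definition nnz (R : realType) (p : nat) (beta : 'cV[R]_p) : nat :=
  #|vsupp beta|.

Definition vrestr (R : realType) (p : nat) (J : {set 'I_p}) (u : 'cV[R]_p) :
    'cV[R]_p :=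
  \col_j (if j \in J then u j 0 else 0).

(* Extended-real valued: ereal_inf set0 = +oo. *)
Definition mu_const (R : realType) (n p : nat) (X : 'M[R]_(n, p))
    (beta : 'cV[R]_p) : \bar R :=
  let J := vsupp beta in
  ereal_inf [set m%:E | m in [set m : R | 0 < m /\
    forall u : 'cV[R]_p,
      l1norm (vrestr (~: J)%SET u) <= 5 * l1norm (vrestr J u) ->
      l2norm (vrestr J u) <= m * ((Num.sqrt n%:R)^-1 * l2norm (X *m u))]].

Definition lasso_objective (R : realType) (n p : nat) (x : 'I_n -> 'cV[R]_p)
    (y : 'I_n -> R) (lambda : R) (beta : 'cV[R]_p) : R :=
  n%:R^-1 * (\sum_(i < n) (y i - ((x i)^T *m beta) 0 0) ^+ 2)
  + lambda * l1norm beta.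

Definition is_lasso (R : realType) (n p : nat) (x : 'I_n -> 'cV[R]_p)
    (y : 'I_n -> R) (lambda : R) (betahat : 'cV[R]_p) : Prop :=
  forall beta : 'cV[R]_p,
    lasso_objective x y lambda betahat <= lasso_objective x y lambda beta.

(* Mutual independence: the product rule for every finite subfamily. *)
Definition mutually_independent (R : realType) (d : measure_display)
    (Omega : measurableType d) (P : probability Omega R) (I : finType)
    (xi : I -> {RV P >-> R}) : Prop :=
  forall (K : {set I}) (B : I -> set R),
    (forall i, measurable (B i)) ->
    P (\bigcap_(i in [set` K]) (xi i @^-1` B i)) =
    (\prod_(i in K) P (xi i @^-1` B i))%E.

(* Main.v *)
Require Import Defs.
From HB Require Import structures.
From mathcomp Require Import all_boot all_order all_algebra.
From mathcomp Require Import all_classical all_reals all_analysis.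
From mathcomp Require Import measurable_realfun.
From mathcomp Require Import ring lra.

Import Order.TTheory GRing.Theory Num.Theory.
Import numFieldNormedType.Exports.

Set Implicit Arguments.
Unset Strict Implicit.
Unset Printing Implicit Defensive.

Local Open Scope classical_set_scope.
Local Open Scope ring_scope.

(** A convexity argument at the minimiser gives, for every beta and with
u = betahat - beta, the sharp basic inequality
  |X(betahat - betastar)|^2/n + |Xu|^2/n
    <= |X(beta - betastar)|^2/n + 2<X^T xi, u>/n + lambda(|beta|_1 - |betahat|_1).
On the event |X^T xi|_oo / n <= lambda/3 the last two terms are at most
lambda(5/3 |u_J|_1 - 1/3 |u_{J^c}|_1), which is negative unless u lies in the
cone defining mu(beta); there |u_J|_1 <= sqrt(M) mu |Xu|_2 / sqrt n, and
|Xu|^2/n absorbs the linear term.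

Each coordinate of X^T xi is a centred Gaussian of variance at most n sigma^2:
Gaussian laws are convolved by completing the square.  The factor
1/sqrt(pi log p) in the probability requires the Mills-ratio tail bound, which
is slightly stronger than a Chernoff bound, followed by a union bound. *)

(** * Gaussian laws *)

(* Canonical-structure inference cannot supply the measurability proof that
   makes a pushforward a measure, hence the explicit instance. *)
Local Notation pushforward_measure :=
  measure_function_pushforward__canonical__measure_function_Measure.

Section lebesgue_affine.
Context {R : realType}.
Local Notation mu := lebesgue_measure.

(** Lebesgue measure is determined by its values on half-open intervals, and [a] times its preimage
    measure under the affine map has those values. *)
Lemma lebesgue_measure_affine (a y : R) (A : set R) : 0 < a -> measurable A ->
  (mu ((fun z => (y + a * z)%R) @^-1` A) = a^-1%:E * mu A)%E.
Proof.
move=> a0 mA.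
have mT : measurable_fun [set: measurableTypeR R]
    (fun z : measurableTypeR R => (y + a * z) : measurableTypeR R).
  by apply: measurable_funD => //; apply: measurable_funM.
pose T (z : R) : R := y + a * z.
pose nu := mscale (NngNum (ltW a0)) (pushforward_measure mu mT).
have nuE B : nu B = (a%:E * mu (T @^-1` B))%E by [].
have -> : mu A = nu A.
  apply: (@lebesgue_measure_unique R nu) => // _ [[u v]] _ <-.
  transitivity (a%:E * mu (T @^-1` `]u, v]))%E; last by [].
  have -> : (T @^-1` `]u, v])%classic = `](u - y) / a, (v - y) / a]%classic.
    apply/seteqP; split => z; rewrite /= !in_itv/= ltr_pdivrMr// ler_pdivlMr//;
      by rewrite ltrBlDl lerBrDl (mulrC z).
  rewrite !lebesgue_measure_itv/= !lte_fin ltr_pM2r ?invr_gt0// ltrD2r.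
  case: ifPn => _; last by rewrite mule0.
  rewrite -!EFinD -EFinM; congr EFin; field.
  by rewrite gt_eqF.
rewrite nuE muleA -EFinM mulVf ?gt_eqF// mul1e.
by [].
Qed.

End lebesgue_affine.

Section normal.
Context {R : realType}.
Local Notation mu := lebesgue_measure.

(** Change of variables: the image of Lebesgue measure is [a^-1] times itself, and this factor turns
    the peak for [tau] into the peak for [a * tau]. *)
Lemma normal_prob_affine_pos (a y tau : R) (C : set R) : 0 < a -> 0 < tau -> measurable C ->
  normal_prob 0 tau ((fun z => y + a * z) @^-1` C) = normal_prob y (a * tau) C.
Proof.
move=> a0 tau0 mC; pose T (z : measurableTypeR R) : measurableTypeR R := y + a * z.
have mT : measurable_fun [set: measurableTypeR R] T.
  by apply: measurable_funD => //; apply: measurable_funM.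
pose f (x : R) := (normal_pdf 0 tau ((x - y) / a))%:E.
have mf : measurable_fun [set: R] f.
  apply/measurable_EFinP/measurableT_comp; first exact: measurable_normal_pdf.
  by apply: measurable_funM => //; exact: measurable_funB.
have f0 x : (0 <= f x)%E by rewrite lee_fin normal_pdf_ge0.
rewrite /normal_prob.
transitivity (\int[mu]_(z in T @^-1` C) ((f \o T) z))%E.
  apply: eq_integral => z _; congr (normal_pdf _ _ _)%:E.
  by rewrite /= /T; field; rewrite gt_eqF.
rewrite -(ge0_integral_pushforward mT)//; last exact: measurable_funTS.
have ai0 : 0 <= a^-1 by rewrite invr_ge0 ltW.
rewrite (eq_measure_integral (mscale (NngNum ai0) mu)); last first.
  by move=> A mA _; exact: lebesgue_measure_affine.
rewrite ge0_integral_mscale//; last exact: measurable_funTS.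
rewrite -ge0_integralZl//=; last exact: measurable_funTS.
apply: eq_integral => x _.
rewrite /f -EFinM !normal_pdfE ?gt_eqF ?mulr_gt0// /normal_peak /normal_fun.
have -> : (a * tau) ^+ 2 * pi *+ 2 = a ^+ 2 * (tau ^+ 2 * pi *+ 2).
  by rewrite exprMn mulrnAr mulrA.
rewrite sqrtrM ?sqr_ge0// sqrtr_sqr gtr0_norm// invfM mulrA.
congr (_ * expR _)%:E; field.
by rewrite !gt_eqF.
Qed.

(** A negative slope reduces to a positive one, since the centred density and Lebesgue measure are
    both invariant under negation. *)
Lemma normal_prob_affine (a y tau : R) (C : set R) : a != 0 -> 0 < tau -> measurable C ->
  normal_prob 0 tau ((fun z => y + a * z) @^-1` C) = normal_prob y (`|a| * tau) C.
Proof.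
move=> a0 tau0 mC.
have [ap|an] := ltP 0 a; first by rewrite gtr0_norm// normal_prob_affine_pos.
have {}an : a < 0 by rewrite lt_neqAle a0.
rewrite ltr0_norm// -normal_prob_affine_pos// ?oppr_gt0//.
pose D := (fun z => y + a * z) @^-1` C.
have mD : measurable D.
  rewrite -[D]setTI; apply: (_ : measurable_fun setT (fun z => y + a * z)) => //.
  by apply: measurable_funD => //; apply: measurable_funM.
have -> : (fun z => y + - a * z) @^-1` C = -%R @^-1` D.
  by apply/funext => z; rewrite /D /preimage/= mulNr mulrN.
rewrite /normal_prob.
transitivity (\int[mu]_(z in -%R @^-1` D)
    (((fun z => (normal_pdf 0 tau z)%:E) \o -%R) z))%E; last first.
  apply: eq_integral => z _; congr EFin.
  by rewrite /= !normal_pdfE ?gt_eqF// /normal_fun !subr0 sqrrN.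
have mN : measurable_fun [set: measurableTypeR R]
  (-%R : measurableTypeR R -> measurableTypeR R) by [].
rewrite -(ge0_integral_pushforward mN)//.
- rewrite -/D.
  apply: (eq_measure_integral (pushforward_measure mu mN)) => A mA _.
  by rewrite -[LHS]lebesgue_measureN.
- by apply/measurable_funTS/measurable_EFinP; exact: measurable_normal_pdf.
- by move=> z _; rewrite lee_fin normal_pdf_ge0.
Qed.
End normal.

(** * Convolution of Gaussian laws *)

Section conv.
Context {R : realType}.
Local Notation mu := lebesgue_measure.

(** Completing the square in [y]. The right side is the marginal density of [x] times the
    conditional density of [y] given [x], so integrating over [y] leaves only the first factor. *)
Lemma normal_pdf_convE (s tau x y : R) : 0 < s -> 0 < tau ->
  let r := Num.sqrt (s ^+ 2 + tau ^+ 2) in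
  normal_pdf 0 s y * normal_pdf y tau x =
  normal_pdf 0 r x * normal_pdf (s ^+ 2 / r ^+ 2 * x) (s * tau / r) y.
Proof.
move=> s0 t0 r.
have r2 : r ^+ 2 = s ^+ 2 + tau ^+ 2.
  by rewrite sqr_sqrtr// addr_ge0// sqr_ge0.
have r0 : 0 < r by rewrite sqrtr_gt0 addr_gt0// exprn_gt0.
rewrite !normal_pdfE ?gt_eqF ?divr_gt0 ?mulr_gt0// /normal_peak /normal_fun.
rewrite mulrACA [RHS]mulrACA -!expRD -!invfM; congr (_^-1 * expR _).
  have h (u : R) : 0 <= u ^+ 2 * pi *+ 2.
    by rewrite mulrn_wge0// mulr_ge0 ?sqr_ge0// pi_ge0.
  rewrite -!sqrtrM//; congr Num.sqrt; field.
  by rewrite gt_eqF.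
have st0 : s ^+ 2 + tau ^+ 2 != 0 by rewrite -r2 gt_eqF// exprn_gt0.
rewrite exprMn exprVn r2; field.
by rewrite !gt_eqF// ?mulr_gt0// -r2 exprn_gt0.
Qed.

(** The Radon-Nikodym derivative of the normal law and [normal_pdf] have the same integral over
    every measurable set, so they agree almost everywhere. *)
Lemma integral_normal_prob (m s : R) (f : R -> \bar R) (U : set R) :
  measurable U -> measurable_fun U f ->
  (\int[normal_prob m s]_(x in U) `|f x| < +oo)%E ->
  (\int[normal_prob m s]_(x in U) f x =
   \int[mu]_(x in U) (f x * (normal_pdf m s x)%:E))%E.
Proof.
move=> mU mf finf.
have dom := normal_prob_dominates m s.
have mpdf : measurable_fun [set: R] (EFin \o normal_pdf m s).
  by apply/measurable_EFinP; exact: measurable_normal_pdf.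
rewrite -(Radon_Nikodym_change_of_variables dom)//=; last first.
  by apply/integrableP; split.
apply: ae_eq_integral => //.
- apply: emeasurable_funM => //; apply: (measurable_int mu).
  apply: (integrableS _ _ (@subsetT _ _)) => //=.
  by apply: Radon_Nikodym_integrable.
- by apply: emeasurable_funM => //=; exact: measurable_funTS mpdf.
- apply: ae_eqe_mul2l => /=.
  rewrite Radon_NikodymE//=.
  case: cid => /= h [h1 h2 h3].
  apply: integral_ae_eq => //=.
  + exact: integrableS h2.
  + exact: measurable_funTS mpdf.
  + by move=> E EU mE; rewrite -h3.
Qed.

(** Joint measurability in mean and point, as Tonelli requires: the density depends only on their
    difference. *)
Lemma measurable_normal_pdf2 (tau : R) : tau != 0 ->
  measurable_fun [set: R * R] (fun z => normal_pdf z.1 tau z.2).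
Proof.
move=> t0; rewrite (_ : (fun z => _) = fun z => normal_peak tau * normal_fun 0 tau (z.2 - z.1)).
  apply: measurable_funM => //; apply: measurableT_comp; first exact: measurable_normal_fun.
  exact: measurable_funB.
by apply/funext => z; rewrite normal_pdfE// /normal_fun subr0.
Qed.

Lemma normal_prob_indic (m s : R) (C : set R) :
  normal_prob m s C = (\int[mu]_x (\1_C x * normal_pdf m s x)%:E)%E.
Proof.
rewrite /normal_prob integral_mkcond; apply: eq_integral => x _.
by rewrite patchE indicE; case: ifPn => _; rewrite ?mul1r ?mul0r.
Qed.

Lemma measurable_normal_prob (tau : R) (C : set R) : tau != 0 -> measurable C ->
  measurable_fun [set: R] (fun y => normal_prob y tau C).
Proof.
move=> t0 mC.
pose g (z : R * R) : \bar R := (\1_C z.2 * normal_pdf z.1 tau z.2)%:E.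
rewrite (_ : (fun y => _) = fubini_F mu g); last first.
  by apply/funext => y; exact: normal_prob_indic.
apply: measurable_fun_fubini_tonelli_F.
  apply/measurable_EFinP/measurable_funM; last exact: measurable_normal_pdf2.
  by apply: measurableT_comp => //; exact: measurable_indic.
by move=> z; rewrite lee_fin mulr_ge0// normal_pdf_ge0.
Qed.

Lemma normal_prob_conv (s tau : R) (C : set R) : 0 < s -> 0 < tau -> measurable C ->
  (\int[normal_prob 0 s]_y normal_prob y tau C)%E =
  normal_prob 0 (Num.sqrt (s ^+ 2 + tau ^+ 2)) C.
Proof.
move=> s0 t0 mC.
set r := Num.sqrt _.
have mN : measurable_fun [set: R] (fun y => normal_prob y tau C).
  by apply: measurable_normal_prob => //; rewrite gt_eqF.
rewrite integral_normal_prob//; last first.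
  (* Integrability: the integrand takes values in [0, 1] and the measure is a probability. *)
  apply: (@le_lt_trans _ _ (\int[normal_prob 0 s]_y 1)%E).
    apply: ge0_le_integral => //; first exact: measurableT_comp.
    by move=> y _; rewrite gee0_abs// probability_le1.
  rewrite integral_cst// mul1e; apply: (@le_lt_trans _ _ 1%E); last exact: ltry.
  exact: probability_le1.
pose h (z : R * R) : \bar R := (\1_C z.2 * normal_pdf z.1 tau z.2 * normal_pdf 0 s z.1)%:E.
transitivity (\int[mu]_y \int[mu]_x h (y, x))%E.
  apply: eq_integral => y _.
  rewrite normal_prob_indic -ge0_integralZr//.
  - apply/measurable_EFinP/measurable_funM; [exact: measurable_indic|exact: measurable_normal_pdf].
  - by move=> x _; rewrite lee_fin mulr_ge0// normal_pdf_ge0.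
  - by rewrite lee_fin normal_pdf_ge0.
rewrite fubini_tonelli//=; last 2 first.
- apply/measurable_EFinP/measurable_funM.
    apply: measurable_funM; last by apply: measurable_normal_pdf2; rewrite gt_eqF.
    by apply: measurableT_comp => //; exact: measurable_indic.
  by apply: measurableT_comp => //; exact: measurable_normal_pdf.
- by move=> z; rewrite lee_fin !mulr_ge0// normal_pdf_ge0.
rewrite normal_prob_indic; apply: eq_integral => x _.
rewrite /h/=.
(* After the exchange of integrals, [normal_pdf_convE] isolates a density in [y] of total mass 1. *)
transitivity (\int[mu]_y ((\1_C x * normal_pdf 0 r x)%:E *
    (normal_pdf (s ^+ 2 / r ^+ 2 * x) (s * tau / r) y)%:E))%E.
  apply: eq_integral => y _; rewrite -EFinM; congr EFin.
  by rewrite -[LHS]mulrA -[RHS]mulrA; congr (_ * _); rewrite mulrC; exact: normal_pdf_convE.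
rewrite ge0_integralZl//.
- by rewrite integral_normal_pdf mule1.
- by apply/measurable_EFinP; exact: measurable_normal_pdf.
- by move=> y _; rewrite lee_fin normal_pdf_ge0.
- by rewrite lee_fin mulr_ge0// normal_pdf_ge0.
Qed.
End conv.

(** * The Mills-ratio tail bound *)

Section tail.
Context {R : realType}.
Local Notation mu := lebesgue_measure.

Lemma is_derive_gauss (c x : R) :
   is_derive x 1 (fun x => expR (c * x ^+ 2) : R) (2 * c * x * expR (c * x ^+ 2)).
Proof.
have h : is_derive x (1:R) (fun x => c * x ^+ 2 : R) (2 * c * x).
  apply: is_derive_eq; change (c * (x * 1 + x * 1) = 2 * c * x); ring.
have H := @is_derive1_comp R expR (fun x => c * x ^+ 2) x _ _ (is_derive_expR _) h.
rewrite mulrC; exact: H.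
Qed.

(* On ]t, +oo[ the density is at most x / t times itself, which has an explicit
   antiderivative. *)
Lemma normal_prob_tail (s t : R) : 0 < s -> 0 < t ->
  (normal_prob 0 s `]t, +oo[ <=
   (s / (t * Num.sqrt (2 * pi)) * expR (- (t ^+ 2 / (2 * s ^+ 2))))%:E)%E.
Proof.
move=> s0 t0.
pose c := - (2 * s ^+ 2)^-1.
have c0 : c < 0 by rewrite oppr_lt0 invr_gt0 mulr_gt0// exprn_gt0.
pose k := s / (t * Num.sqrt (2 * pi)).
pose F (x : R) : R := (- k) * expR (c * x ^+ 2).
pose f (x : R) : R := x / t * normal_pdf 0 s x.
have sp0 : 0 < Num.sqrt (2 * pi) :> R by rewrite sqrtr_gt0 mulr_gt0 ?pi_gt0.
have dF (x : R) : is_derive x 1 F (f x).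
  have := is_deriveZ (- k) (is_derive_gauss c x).
  have -> : (- k) *: (2 * c * x * expR (c * x ^+ 2)) = f x; last by [].
  change ((- k) * (2 * c * x * expR (c * x ^+ 2)) = f x).
  rewrite /f normal_pdfE ?gt_eqF// /normal_peak /normal_fun.
  have -> : s ^+ 2 * pi *+ 2 = s ^+ 2 * (2 * pi) by rewrite -mulr_natr; ring.
  rewrite sqrtrM ?sqr_ge0// sqrtr_sqr gtr0_norm// subr0.
  have -> : - x ^+ 2 / (s ^+ 2 *+ 2) = c * x ^+ 2.
    by rewrite /c -mulr_natl mulrC mulrN mulNr.
  rewrite /k /c; move: (expR _) (Num.sqrt (2 * pi)) sp0 => e q q0; field.
  by rewrite !gt_eqF.
have cF : continuous F.
  by move=> x; apply: differentiable_continuous; apply/derivable1_diffP; exact: @ex_derive.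
have cf : continuous f.
  move=> x; apply: cvgM; last by apply: continuous_normal_pdf; rewrite gt_eqF.
  by apply: cvgM; [exact: cvg_id|exact: cvg_cst].
have F0 : F x @[x --> +oo%R] --> (0 : R).
  rewrite -(mulr0 (- k)); apply: cvgM; first exact: cvg_cst.
  rewrite (_ : (fun x => _) = (fun x => expR (- x)) \o (fun x => - c * x ^+ 2)); last first.
    by apply/funext => x /=; rewrite mulNr opprK.
  apply: (cvg_comp (fun x => - c * x ^+ 2) (fun x => expR (- x))); last exact: cvgr_expR.
  by apply: gt0_cvgMry; [rewrite oppr_gt0|exact: cvgr_expr2].
(* The bound is the increment of the antiderivative [F] from [t] to infinity, where [F] tends to
   0. *)
have -> : (k * expR (- (t ^+ 2 / (2 * s ^+ 2))))%:E = (0%:E - (F t)%:E)%E.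
  rewrite /F sub0e -EFinN mulNr opprK; congr (_ * expR _)%:E.
  by rewrite /c mulNr mulrC.
rewrite -(@ge0_continuous_FTC2y _ f F t)//.
- have mf : measurable_fun [set: R] (EFin \o f).
    by apply/measurable_EFinP; exact: continuous_measurable_fun.
  have f0 (x : R) : t < x -> (0 <= (f x)%:E)%E.
    by move=> tx; rewrite lee_fin mulr_ge0 ?normal_pdf_ge0// divr_ge0// ltW// (lt_trans t0).
  rewrite -integral_itv_obnd_cbnd; last exact: measurable_funTS.
  apply: ge0_le_integral => //=.
  + by move=> x _; rewrite lee_fin normal_pdf_ge0.
  + by apply/measurable_funTS/measurable_EFinP; exact: measurable_normal_pdf.
  + exact: measurable_funTS.
  + move=> x; rewrite in_itv/= andbT => tx; rewrite lee_fin /f ler_peMl ?normal_pdf_ge0//.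
    by rewrite ler_pdivlMr// mul1r ltW.
- by move=> x tx; rewrite mulr_ge0// ?normal_pdf_ge0// divr_ge0// ltW// (lt_le_trans t0).
- exact: continuous_subspaceT.
- exact/cvg_at_right_filter/cF.
- by move=> x _; rewrite derive1E; exact: derive_val.
Qed.
End tail.

(* The centred Gaussian law with standard deviation s; the case split is needed
   because the library's normal_prob 0 0 is the uniform law on [0, 1]. *)
Definition cgauss (R : realType) (s : R) : set R -> \bar R :=
  if s == 0 then \d_(0 : R) else normal_prob 0 s.

(** * Laws of sums of independent Gaussian variables *)

Section joint.
Context {R : realType} d (Omega : measurableType d) (P : probability Omega R).

(* The event E stands for constraints on the variables not yet summed. *)
Lemma joint_law (S xi : Omega -> R) (E : set Omega)
    (m1 m2 : probability (measurableTypeR R) R) :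
  measurable_fun setT S -> measurable_fun setT xi -> measurable E ->
  (forall A B, measurable A -> measurable B ->
    P (S @^-1` A `&` xi @^-1` B `&` E) = (m1 A * m2 B * P E)%E) ->
  forall D : set (measurableTypeR R * measurableTypeR R), measurable D ->
    P ((fun w => (S w, xi w)) @^-1` D `&` E) = ((m1 \x m2)%E D * P E)%E.
Proof.
move=> mS mxi mE H D mD.
have mf : measurable_fun [set: Omega]
    (fun w => (S w, xi w) : measurableTypeR R * measurableTypeR R).
  exact: measurable_fun_pair.
have mfD : measurable ((fun w => (S w, xi w)) @^-1` D).
  by rewrite -[X in measurable X]setTI; exact: mf.
(* A null event makes both sides vanish; otherwise one may condition on [E]. *)
have [PE0|PE0] := eqVneq (P E) 0%E.
  rewrite PE0 mule0; apply/eqP; rewrite -measure_le0 -PE0.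
  by apply: le_measure; rewrite ?inE//; exact: measurableI.
have PEfin : P E \is a fin_num by exact: fin_num_measure.
have c0 : 0 < fine (P E).
  by rewrite fine_gt0// lt0e PE0 /= measure_ge0 ltey_eq PEfin.
have ci0 : 0 <= (fine (P E))^-1 by rewrite invr_ge0 ltW.
(* [nu] is the conditional law of the pair given [E]. It agrees with the product measure on
   rectangles, hence everywhere. *)
pose nu := mscale (NngNum ci0)
  (pushforward_measure (mrestr P mE) mf).
have cK (u v : \bar R) : u = (v * P E)%E -> ((fine (P E))^-1%:E * u = v)%E.
  move=> ->; rewrite muleCA -[X in (_ * (_ * X))%E]fineK// -EFinM mulVf ?gt_eqF//.
  by rewrite mule1.
have /(_ D mD) -> : forall X, measurable X -> (m1 \x m2)%E X = nu X.
  apply: product_measure_unique => A B mA mB.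
  apply: cK; rewrite -H//.
transitivity (((fine (P E))^-1%:E * P ((fun w => (S w, xi w)) @^-1` D `&` E)) * P E)%E;
  last by [].
by rewrite muleAC -[X in (_ * X * _)%E]fineK// -EFinM mulVf ?gt_eqF// mul1e.
Qed.

(** Slicing the product measure along the first coordinate [y] turns each section into a normal
    probability with mean [y], which leaves the convolution integral. *)
Lemma gaussian_convolution (s a tau : R) (C : set R)
    (m1 m2 : probability (measurableTypeR R) R) :
  0 <= s -> a != 0 -> 0 < tau -> measurable C ->
  m1 = cgauss s :> (set R -> \bar R) ->
  m2 = normal_prob 0 tau :> (set R -> \bar R) ->
  ((m1 \x m2) ((fun z : R * R => z.1 + a * z.2)%R @^-1` C) =
  cgauss (Num.sqrt (s ^+ 2 + (a * tau) ^+ 2)) C)%E.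
Proof.
move=> s0 a0 tau0 mC m1E m2E.
have at0 : 0 < `|a| * tau by rewrite mulr_gt0// normr_gt0.
have -> : (a * tau) ^+ 2 = (`|a| * tau) ^+ 2.
  by rewrite !exprMn real_normK// num_real.
transitivity (\int[m1]_y normal_prob y (`|a| * tau) C)%E.
  apply: eq_integral => y _ /=; rewrite m2E -normal_prob_affine//.
  by congr normal_prob; apply/seteqP; split => z; rewrite /xsection/= inE.
have mN : measurable_fun [set: R] (fun y => normal_prob y (`|a| * tau) C).
  by apply: measurable_normal_prob => //; rewrite gt_eqF.
have int_eq (m : probability (measurableTypeR R) R) :
    m1 = m :> (set R -> \bar R) ->
    (\int[m1]_y normal_prob y (`|a| * tau) C = \int[m]_y normal_prob y (`|a| * tau) C)%E.
  move=> e; apply: (@eq_measure_integral _ (measurableTypeR R)) => A mA _.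
  exact: (congr1 (@^~ A) e).
(* For [s = 0] the first law is the Dirac mass at 0, and the integral is the integrand evaluated
   there. *)
have [s00|s00] := eqVneq s 0.
  rewrite (int_eq (\d_(0 : measurableTypeR R))); last by rewrite m1E /cgauss s00 eqxx.
  rewrite integral_dirac// diracT mul1e s00 expr0n/= add0r sqrtr_sqr.
  by rewrite (gtr0_norm at0) /cgauss gt_eqF.
have {}s0 : 0 < s by rewrite lt_neqAle eq_sym s00.
rewrite (int_eq (normal_prob 0 s)); last by rewrite m1E /cgauss (negbTE s00).
rewrite normal_prob_conv// /cgauss gt_eqF// sqrtr_gt0 addr_gt0//.
  exact: exprn_gt0.
exact: exprn_gt0.
Qed.

Lemma cgauss_probability (s : R) :
  exists m : probability (measurableTypeR R) R, m = cgauss s :> (set R -> \bar R).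
Proof.
rewrite /cgauss; case: ifPn => _; first by exists \d_(0 : measurableTypeR R).
by exists (normal_prob 0 s).
Qed.

(** One more summand, still independent of [E]. The case [a = 0] is separate because the map on the
    new variable is then not invertible. *)
Lemma gaussian_sum_step (S xi : Omega -> R) (E : set Omega) (s a tau : R) :
  0 <= s -> 0 < tau ->
  measurable_fun setT S -> measurable_fun setT xi -> measurable E ->
  (forall A B, measurable A -> measurable B ->
    P (S @^-1` A `&` xi @^-1` B `&` E) = (cgauss s A * normal_prob 0 tau B * P E)%E) ->
  forall C : set R, measurable C ->
    P ((fun w => S w + a * xi w) @^-1` C `&` E) =
    (cgauss (Num.sqrt (s ^+ 2 + (a * tau) ^+ 2)) C * P E)%E.
Proof.
move=> s0 tau0 mS mxi mE H C mC.
have [m1 m1E] := cgauss_probability s.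
have [->|a0] := eqVneq a 0.
  have -> : (fun w => S w + 0 * xi w) = S by apply/funext => w; rewrite mul0r addr0.
  rewrite mul0r expr0n/= addr0 sqrtr_sqr ger0_norm//.
  have := H C setT mC measurableT.
  by rewrite preimage_setT setIT (probability_setT (normal_prob 0 tau)) mule1.
pose m2 : probability (measurableTypeR R) R := normal_prob 0 tau.
rewrite -(@gaussian_convolution s a tau C m1 m2)//.
have mh : measurable_fun [set: measurableTypeR R * measurableTypeR R]
    (fun z => z.1 + a * z.2 : R).
  by apply: measurable_funD => //; apply: measurable_funM.
rewrite -(@joint_law S xi E)//.
- by move=> A B mA mB; rewrite H// m1E.
- by rewrite -[X in measurable X]setTI; exact: mh.
Qed.
End joint.

Section sum.
Context {R : realType} d (Omega : measurableType d) (P : probability Omega R).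
Context (I : finType) (xi : I -> {RV P >-> R}) (tau : R).
Context (tau0 : 0 < tau) (hind : mutually_independent xi).
Context (hgauss : forall (i : I) (B : set R), measurable B ->
  distribution P (xi i) B = normal_prob 0 tau B).

Lemma measurable_lincomb (a : I -> R) (r : seq I) :
  measurable_fun [set: Omega] (fun w => \sum_(i <- r) a i * xi i w).
Proof. by apply: measurable_sum => i; apply: measurable_funM. Qed.

(** The constraints on the indices in [K] strengthen the induction: removing [i] from the list moves
    it into [K], which supplies the independence of [xi i] from the remaining sum. *)
Lemma gaussian_sum_indep (a : I -> R) (r : seq I) (K : {set I}) (B : I -> set R) (A : set R) :
  uniq r -> {in r, forall i, i \notin K} -> measurable A ->
  (forall i, measurable (B i)) ->
  P ((fun w => \sum_(i <- r) a i * xi i w) @^-1` A `&`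
     \bigcap_(i in [set` K]) (xi i @^-1` B i)) =
  (cgauss (Num.sqrt (\sum_(i <- r) (a i * tau) ^+ 2)) A *
   P (\bigcap_(i in [set` K]) (xi i @^-1` B i)))%E.
Proof.
elim: r K B A => [|i r IH] K B A /=.
  move=> _ _ mA mB.
  rewrite big_nil sqrtr0 /cgauss eqxx diracE.
  have -> : (fun w : Omega => \sum_(i <- [::]) a i * xi i w) = cst 0.
    by apply/funext => w; rewrite big_nil.
  rewrite preimage_cst; case: ifPn => _; first by rewrite setTI mul1e.
  by rewrite set0I measure0 mul0e.
move=> /andP[ir ur] rK mA mB.
have iK : i \notin K by apply: rK; rewrite mem_head.
have -> : (fun w => \sum_(j <- i :: r) a j * xi j w) =
    (fun w => (\sum_(j <- r) a j * xi j w) + a i * xi i w).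
  by apply/funext => w; rewrite big_cons addrC.
have mE : measurable (\bigcap_(i in [set` K]) (xi i @^-1` B i)).
  apply: fin_bigcap_measurable => // j _.
  by rewrite -[X in measurable X]setTI; exact: measurable_funPT.
have sum0 : 0 <= \sum_(j <- r) (a j * tau) ^+ 2 by apply: sumr_ge0 => j _; exact: sqr_ge0.
set E := \bigcap_(i in _) _ in mE *.
pose v := \sum_(j <- r) (a j * tau) ^+ 2.
transitivity (cgauss (Num.sqrt (Num.sqrt v ^+ 2 + (a i * tau) ^+ 2)) A * P E)%E; last first.
  by congr (cgauss (Num.sqrt _) A * P E)%E; rewrite (sqr_sqrtr sum0) big_cons; exact: addrC.
have mS := measurable_lincomb a r.
apply: (@gaussian_sum_step _ _ _ P _ _ E (Num.sqrt v) (a i) tau _ tau0 mS _ mE _ A mA) => //.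
move=> A' B' mA' mB'.
(* The constraint on [xi i] joins the family, so that the induction hypothesis applies to
   [i |: K]. *)
pose B2 j := if j == i then B' else B j.
have mB2 j : measurable (B2 j) by rewrite /B2; case: ifP.
have B2E : \bigcap_(j in [set` i |: K]) (xi j @^-1` B2 j) =
   xi i @^-1` B' `&` \bigcap_(j in [set` K]) (xi j @^-1` B j).
  apply/seteqP; split => w /=.
    move=> H; split; first by have := H i; rewrite /B2 eqxx/=; apply; rewrite setU11.
    move=> j /= jK; have := H j; rewrite /B2/= (negbTE (memPn iK _ jK)); apply.
    by rewrite setU1r.
  move=> [wi H] j /=; rewrite /B2 in_setU1; have [->//|ji /=] := eqVneq j i.
  exact: H.
rewrite -setIA /E -B2E IH//; last first.
  move=> j jr; rewrite in_setU1 negb_or rK ?in_cons ?jr ?orbT// andbT.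
  by apply: contraNneq ir => <-.
rewrite -muleA; congr (_ * _)%E.
rewrite !hind// big_setU1//= {1}/B2 eqxx; congr (_ * _)%E.
  exact: hgauss.
by apply: eq_bigr => j jK; rewrite /B2 (negbTE (memPn iK _ jK)).
Qed.

Lemma gaussian_lincomb (a : I -> R) (A : set R) : measurable A ->
  P ((fun w => \sum_i a i * xi i w) @^-1` A) =
  cgauss (Num.sqrt (\sum_i (a i * tau) ^+ 2)) A.
Proof.
move=> mA.
have := @gaussian_sum_indep a (index_enum I) finset.set0 (fun=> setT) A
  (index_enum_uniq _) _ mA _.
rewrite (_ : [set` finset.set0] = set0); last first.
  by apply/seteqP; split => // x /=; rewrite inE.
rewrite bigcap_set0 setIT probability_setT mule1; apply=> //.
by move=> j _; rewrite inE.
Qed.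

End sum.

Section cgauss_tail.
Context {R : realType}.

(** The one-sided bound increases with the standard deviation, so [s0] may replace [s]; symmetry
    gives the factor 2. In the degenerate case the probability is 0 because [t] is positive. *)
Lemma cgauss_tail (s s0 t : R) : 0 <= s -> s <= s0 -> 0 < s0 -> 0 < t ->
  (cgauss s [set z : R | (t < `|z|)%R] <=
   (2 * (s0 / (t * Num.sqrt (2 * pi)) * expR (- (t ^+ 2 / (2 * s0 ^+ 2)))))%:E)%E.
Proof.
move=> sge0 ss0 s00 t0.
have sp0 : 0 < Num.sqrt (2 * pi) :> R by rewrite sqrtr_gt0 mulr_gt0 ?pi_gt0.
rewrite /cgauss; have [_|sn0] := eqVneq s 0.
  rewrite diracE memNset//=; last by rewrite normr0 ltNge ltW.
  by rewrite lee_fin !mulr_ge0 ?expR_ge0// ltW// invr_gt0 mulr_gt0.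
have {sn0}sgt0 : 0 < s by rewrite lt_neqAle eq_sym sn0.
have -> : [set z : R | t < `|z|] = `]t, +oo[ `|` (fun z => 0 + -1 * z) @^-1` `]t, +oo[.
  apply/seteqP; split => z /=; rewrite !in_itv/= !andbT add0r mulN1r ltr_normr.
    by move/orP.
  by move=> H; apply/orP.
apply: (@le_trans _ _ (normal_prob 0 s `]t, +oo[ + normal_prob 0 s `]t, +oo[)%E).
  rewrite -[X in (_ <= _ + X)%E](_ :
    normal_prob 0 s ((fun z => 0 + -1 * z) @^-1` `]t, +oo[) = _); last first.
    by rewrite normal_prob_affine ?oppr_eq0 ?oner_eq0// normrN1 mul1r.
  apply: measureU2 => //.
  rewrite -[X in measurable X]setTI.
  apply: (_ : measurable_fun setT (fun z : R => 0 + -1 * z)) => //.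
  by apply: measurable_funD => //; apply: measurable_funM.
have : (normal_prob 0 s `]t, +oo[ <=
   (s0 / (t * Num.sqrt (2 * pi)) * expR (- (t ^+ 2 / (2 * s0 ^+ 2))))%:E)%E.
  apply: (le_trans (normal_prob_tail sgt0 t0)); rewrite lee_fin.
  apply: ler_pM; rewrite ?expR_ge0//.
  - by rewrite divr_ge0// ltW// mulr_gt0.
  - by rewrite ler_pM2r// invr_gt0 mulr_gt0.
  - rewrite ler_expR lerN2 ler_pM2l ?exprn_gt0// lef_pV2 ?posrE ?mulr_gt0 ?exprn_gt0//.
    by rewrite ler_pM2l// lerXn2r// nnegrE ltW.
by move=> H; rewrite mulr_natl mulr2n EFinD; exact: leeD.
Qed.
End cgauss_tail.

(** * The deterministic oracle inequality *)

Section lasso_det.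
Context {R : realType}.
Implicit Types (n p : nat).

(** The first-order condition at a minimum: near 0 the linear term dominates the quadratic one. *)
Lemma ge0_of_small_quadratic (h g : R) : (forall t, 0 < t -> t <= 1 -> 0 <= t * g + t ^+ 2 * h) ->
  0 <= g.
Proof.
move=> H; rewrite leNgt; apply/negP => g0.
have k0 : 0 < `|h| - g + 1 by have := normr_ge0 h; lra.
(* This choice is at most 1 and gives [t * |h| < - g], contradicting the hypothesis. *)
set t := - g / (`|h| - g + 1).
have t0 : 0 < t by rewrite divr_gt0// oppr_gt0.
have t1 : t <= 1 by rewrite ler_pdivrMr// mul1r; have := normr_ge0 h; lra.
have := H t t0 t1; apply/negP; rewrite -ltNge.
rewrite expr2 -mulrA -mulrDr pmulr_rlt0//.
have : t * h <= t * `|h| by rewrite ler_pM2l// ler_norm.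
have : t * `|h| < - g.
  rewrite /t mulrAC ltr_pdivrMr// ltr_pM2l ?oppr_gt0//; lra.
lra.
Qed.

Lemma l1norm_convex p (t : R) (u v : 'cV[R]_p) : 0 <= t -> t <= 1 ->
  l1norm (u + t *: (v - u)) <= l1norm u + t * (l1norm v - l1norm u).
Proof.
move=> t0 t1; rewrite /l1norm mulrBr !mulr_sumr -sumrB -big_split/=.
apply: ler_sum => j _; rewrite !mxE.
have -> : u j 0 + t * (v j 0 - u j 0) = (1 - t) * u j 0 + t * v j 0 by ring.
rewrite (le_trans (ler_normD _ _))// !normrM (ger0_norm t0) ger0_norm; lra.
Qed.

(** Stationarity without subgradients: the objective at [bh] is compared with that at
    [bh + t *: (beta - bh)]. The penalty is bounded by convexity, and the quadratic part of the loss
    is the second-order remainder. *)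
Lemma lasso_optimality n p (x : 'I_n -> 'cV[R]_p) (y : 'I_n -> R) (lambda : R)
    (bh beta : 'cV[R]_p) : 0 <= lambda -> is_lasso x y lambda bh ->
  2 * n%:R^-1 * (\sum_(i < n) (y i - ((x i)^T *m bh) 0 0) *
      (((x i)^T *m beta) 0 0 - ((x i)^T *m bh) 0 0)) <=
  lambda * (l1norm beta - l1norm bh).
Proof.
move=> l0 hl; pose f (c : 'cV[R]_p) i := ((x i)^T *m c) 0 0.
rewrite -subr_ge0.
apply: (@ge0_of_small_quadratic (n%:R^-1 * \sum_(i < n) (f beta i - f bh i) ^+ 2)) => t t0 t1.
have := hl (bh + t *: (beta - bh)); rewrite /lasso_objective.
have fE i : ((x i)^T *m (bh + t *: (beta - bh))) 0 0 = f bh i + t * (f beta i - f bh i).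
  by rewrite /f mulmxDr -scalemxAr mulmxBr !mxE.
under [X in _ <= _ * X + _ -> _]eq_bigr do rewrite fE.
have -> : \sum_(i < n) (y i - (f bh i + t * (f beta i - f bh i))) ^+ 2 =
   \sum_(i < n) (y i - f bh i) ^+ 2
   - 2 * t * (\sum_(i < n) (y i - f bh i) * (f beta i - f bh i))
   + t ^+ 2 * \sum_(i < n) (f beta i - f bh i) ^+ 2.
  rewrite !mulr_sumr -sumrB -big_split/=; apply: eq_bigr => i _; ring.
have := ler_wpM2l l0 (l1norm_convex bh beta (ltW t0) t1).
rewrite -/(f bh). lra.
Qed.

Lemma lasso_basic n p (x : 'I_n -> 'cV[R]_p) (X : 'M[R]_(n, p)) (xi : 'I_n -> R)
   (betastar : 'cV[R]_p) (lambda : R) (bh beta : 'cV[R]_p) :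
  X = \matrix_(i < n) (x i)^T -> 0 <= lambda ->
  is_lasso x (fun i => ((x i)^T *m betastar) 0 0 + xi i) lambda bh ->
  n%:R^-1 * l2norm (X *m (bh - betastar)) ^+ 2
   + n%:R^-1 * l2norm (X *m (bh - beta)) ^+ 2
  <= n%:R^-1 * l2norm (X *m (beta - betastar)) ^+ 2
   + 2 * n%:R^-1 * (\sum_j (\sum_i xi i * X i j) * (bh - beta) j 0)
   + lambda * (l1norm beta - l1norm bh).
Proof.
move=> hX l0 hl; move: (lasso_optimality beta l0 hl).
have fE (c : 'cV[R]_p) i : ((x i)^T *m c) 0 0 = (X *m c) i 0.
  by rewrite hX !mxE; apply: eq_bigr => k _; rewrite !mxE.
have l2E (v : 'cV[R]_n) : l2norm v ^+ 2 = \sum_i v i 0 ^+ 2.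
  by rewrite sqr_sqrtr// sumr_ge0// => i _; rewrite sqr_ge0.
have mE (u v : 'cV[R]_n) i : (u - v) i 0 = u i 0 - v i 0 by rewrite !mxE.
rewrite !l2E.
have -> : \sum_j (\sum_i xi i * X i j) * (bh - beta) j 0 =
          \sum_i xi i * (X *m (bh - beta)) i 0.
  under eq_bigr do rewrite mulr_suml.
  rewrite exchange_big/=; apply: eq_bigr => i _.
  by rewrite mxE mulr_sumr; apply: eq_bigr => j _; rewrite mulrA.
set S1 := \sum_(i < n) _ * _; set S2 := \sum_i xi i * _.
set A1 := \sum_i _; set A2 := \sum_i _; set A3 := \sum_i _.
(* Polarisation, 2ac = a^2 + c^2 - (a - c)^2, in each coordinate, with the noise contribution split
   off. The term [A2] it yields makes the inequality sharp. *)
have -> : 2 * n%:R^-1 * S1 = n%:R^-1 * (A1 + A2 - A3 - 2 * S2).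
  rewrite [2 * _]mulrC -mulrA; congr (_ * _); rewrite /S1 /A1 /A2 /A3 /S2.
  rewrite !mulr_sumr -big_split/= -!sumrB; apply: eq_bigr => i _.
  by rewrite !fE !mulmxBr !mE; ring.
lra.
Qed.

End lasso_det.

(** * Support decomposition, the cone condition and the oracle bound *)

Section det.
Context {R : realType}.

(** Cauchy-Schwarz, from the nonnegativity of the sum of squared deviations from the mean [m]. *)
Lemma sqr_sum_le_card (I : finType) (J : {set I}) (a : I -> R) :
  (\sum_(j in J) a j) ^+ 2 <= #|J|%:R * \sum_(j in J) a j ^+ 2.
Proof.
have [J0|J0] := posnP #|J|.
  by rewrite (cards0_eq J0) !big_set0 mulr0 expr0n.
set S := \sum_(j in J) a j; set Q := \sum_(j in J) _.
have M0 : 0 < #|J|%:R :> R by rewrite ltr0n.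
pose m := S / #|J|%:R.
have : 0 <= \sum_(j in J) (a j - m) ^+ 2 by apply: sumr_ge0 => j _; exact: sqr_ge0.
have -> : \sum_(j in J) (a j - m) ^+ 2 = Q - 2 * m * S + #|J|%:R * m ^+ 2.
  rewrite /Q /S [#|J|%:R * _]mulr_natl -sumr_const mulr_sumr -sumrB -big_split/=.
  by apply: eq_bigr => j _; ring.
have -> : Q - 2 * m * S + #|J|%:R * m ^+ 2 = Q - S ^+ 2 / #|J|%:R.
  by rewrite /m; field; rewrite gt_eqF.
by rewrite subr_ge0 ler_pdivrMr// mulrC.
Qed.

Lemma l1norm_vrestr p (J : {set 'I_p}) (u : 'cV[R]_p) :
  l1norm (vrestr J u) = \sum_(j in J) `|u j 0|.
Proof.
rewrite /l1norm [RHS]big_mkcond; apply: eq_bigr => j _.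
by rewrite mxE; case: ifP => // _; rewrite normr0.
Qed.

Lemma sqr_l1norm_vrestr_le p (J : {set 'I_p}) (u : 'cV[R]_p) :
  l1norm (vrestr J u) ^+ 2 <= #|J|%:R * l2norm (vrestr J u) ^+ 2.
Proof.
rewrite l1norm_vrestr; apply: le_trans (sqr_sum_le_card _ _) _.
rewrite /l2norm sqr_sqrtr ?sumr_ge0// => [|j _]; last exact: sqr_ge0.
rewrite big_mkcond/= ler_pM// ?sumr_ge0// => [j _|].
  by case: ifP => // _; exact: sqr_ge0.
apply: ler_sum => j _; rewrite mxE; case: ifP => // _.
by rewrite real_normK// num_real.
Qed.

Lemma l1norm_split p (J : {set 'I_p}) (u : 'cV[R]_p) :
  l1norm u = l1norm (vrestr J u) + l1norm (vrestr (~: J)%SET u).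
Proof.
rewrite !l1norm_vrestr /l1norm (bigID (mem J))/=; congr (_ + _).
by apply: eq_bigl => j; rewrite inE.
Qed.

(** On the support this is the reverse triangle inequality; off it [beta] vanishes, so [v - beta]
    coincides with [v]. *)
Lemma l1norm_supp_sub p (beta v : 'cV[R]_p) :
  l1norm beta - l1norm v <= l1norm (vrestr (vsupp beta) (v - beta))
    - l1norm (vrestr (~: vsupp beta)%SET (v - beta)).
Proof.
rewrite (l1norm_split (vsupp beta) beta) (l1norm_split (vsupp beta) v) !l1norm_vrestr.
have bJ j : j \in (~: vsupp beta)%SET -> beta j 0 = 0.
  by rewrite !inE negbK => /eqP.
have -> : \sum_(j in (~: vsupp beta)%SET) `|beta j 0| = 0.
  by apply: big1 => j /bJ ->; rewrite normr0.
have -> : \sum_(j in (~: vsupp beta)%SET) `|(v - beta) j 0| =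
    \sum_(j in (~: vsupp beta)%SET) `|v j 0|.
  by apply: eq_bigr => j /bJ h; rewrite !mxE h subr0.
rewrite addr0 opprD addrA lerD2r -sumrB; apply: ler_sum => j _.
by rewrite !mxE distrC lerB_dist.
Qed.

(** The number [k] stands for mu^2 M. Keeping it abstract also covers an empty support, where
    [k = 0] works even if mu is infinite. *)
Lemma lasso_oracle n p (x : 'I_n -> 'cV[R]_p) (X : 'M[R]_(n, p)) (xi : 'I_n -> R)
   (betastar : 'cV[R]_p) (lambda k : R) (bh beta : 'cV[R]_p) :
  (0 < n)%N -> X = \matrix_(i < n) (x i)^T -> 0 <= lambda -> 0 <= k ->
  is_lasso x (fun i => ((x i)^T *m betastar) 0 0 + xi i) lambda bh ->
  (forall j, `|\sum_i X i j * xi i| <= n%:R * lambda / 3) ->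
  (forall u, l1norm (vrestr (~: vsupp beta)%SET u) <= 5 * l1norm (vrestr (vsupp beta) u) ->
     l1norm (vrestr (vsupp beta) u) ^+ 2 <= k * (n%:R^-1 * l2norm (X *m u) ^+ 2)) ->
  n%:R^-1 * l2norm (X *m (bh - betastar)) ^+ 2 <=
  n%:R^-1 * l2norm (X *m (beta - betastar)) ^+ 2 + lambda ^+ 2 * k.
Proof.
move=> n0 hX l0 k0 hl noise cone.
have n0' : 0 < n%:R :> R by rewrite ltr0n.
have := lasso_basic beta hX l0 hl.
have H1 := ler_wpM2l l0 (l1norm_supp_sub beta bh).
have H2 : 2 * n%:R^-1 * (\sum_j (\sum_i xi i * X i j) * (bh - beta) j 0) <=
   2 * lambda / 3 * l1norm (bh - beta).
  have -> : 2 * lambda / 3 * l1norm (bh - beta) =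
     2 * n%:R^-1 * (n%:R * lambda / 3 * l1norm (bh - beta)) by field; rewrite gt_eqF.
  rewrite ler_pM2l ?mulr_gt0 ?invr_gt0// /l1norm mulr_sumr; apply: ler_sum => j _.
  apply: (le_trans (ler_norm _)); rewrite normrM ler_wpM2r//.
  by under eq_bigr do rewrite mulrC; exact: noise.
rewrite (l1norm_split (vsupp beta) (bh - beta)) in H2.
have := cone (bh - beta).
set a := l1norm (vrestr (vsupp beta) _) in H1 H2 *.
set c := l1norm (vrestr (~: _)%SET _) in H1 H2 *.
set Q := n%:R^-1 * l2norm (X *m (bh - beta)) ^+ 2.
have Q0 : 0 <= Q by rewrite mulr_ge0 ?invr_ge0 ?sqr_ge0 ?ltW.
have a0 : 0 <= a by apply: sumr_ge0.
have kl0 : 0 <= lambda ^+ 2 * k by rewrite mulr_ge0// sqr_ge0.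
(* [H1] and [H2] add up to [lambda * (5 / 3 * a - 1 / 3 * c)], which is where the constant 5 of the
   cone comes from. *)
have [ca|ca] := leP c (5 * a); last first.
  have := ler_wpM2l l0 (ltW ca); lra.
move=> /(_ isT) ak.
(* Since [a ^+ 2 <= k * Q], the square of the left side is at most 25/9 of [lambda ^+ 2 * k * Q],
   while the square of the right side is at least 4 times that product. *)
have H3 : 5 / 3 * (lambda * a) <= Q + lambda ^+ 2 * k.
  have y0 : 0 <= Q + lambda ^+ 2 * k by exact: addr_ge0.
  have x0 : 0 <= 5 / 3 * (lambda * a) by apply: mulr_ge0 => //; exact: mulr_ge0.
  rewrite -(@ler_pXn2r _ 2)//.
  have := ler_wpM2l (sqr_ge0 lambda) ak.
  have := sqr_ge0 (Q - lambda ^+ 2 * k).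
  have : 0 <= lambda ^+ 2 * (k * Q) by apply: mulr_ge0; [exact: sqr_ge0|exact: mulr_ge0].
  nra.
have lc0 : 0 <= lambda * c by rewrite mulr_ge0//; apply: sumr_ge0.
lra.
Qed.

(** A finite infimum is itself admissible in the cone inequality: dividing by [q > 0] shows that
    [l / q] is a lower bound of the admissible constants. *)
Lemma mu_const_le n p (X : 'M[R]_(n, p)) (beta : 'cV[R]_p) (r : R) (u : 'cV[R]_p) :
  mu_const X beta = r%:E ->
  l1norm (vrestr (~: vsupp beta)%SET u) <= 5 * l1norm (vrestr (vsupp beta) u) ->
  l2norm (vrestr (vsupp beta) u) <= r * ((Num.sqrt n%:R)^-1 * l2norm (X *m u)).
Proof.
rewrite /mu_const; set M := [set m : R | _] => Mr hu.
set q := (Num.sqrt n%:R)^-1 * _; set l := l2norm _.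
have q0 : 0 <= q by rewrite mulr_ge0 ?invr_ge0 ?sqrtr_ge0.
have lM m : M m -> l <= m * q by move=> [_ /(_ u hu)].
have [m Mm] : exists m, M m.
  apply/set0P/eqP => M0; move: Mr; rewrite M0 image_set0 ereal_inf0//.
(* Division is impossible here, but any admissible constant already forces [l <= 0]. *)
have [q00|q00] := eqVneq q 0.
  by have := lM _ Mm; rewrite q00 !mulr0.
have {}q0 : 0 < q by rewrite lt_neqAle eq_sym q00.
rewrite -ler_pdivrMr// -lee_fin -Mr; apply: le_ereal_inf_tmp => _ [m' Mm' <-].
by rewrite lee_fin ler_pdivrMr//; exact: lM.
Qed.

Lemma mu_const_ge0 n p (X : 'M[R]_(n, p)) (beta : 'cV[R]_p) : (0 <= mu_const X beta)%E.
Proof. by apply: le_ereal_inf_tmp => _ [m [m0 _] <-]; rewrite lee_fin ltW. Qed.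

Lemma lasso_oracle_mu n p (x : 'I_n -> 'cV[R]_p) (X : 'M[R]_(n, p)) (xi : 'I_n -> R)
   (betastar : 'cV[R]_p) (lambda : R) (bh beta : 'cV[R]_p) :
  (0 < n)%N -> X = \matrix_(i < n) (x i)^T -> 0 < lambda ->
  is_lasso x (fun i => ((x i)^T *m betastar) 0 0 + xi i) lambda bh ->
  (forall j, `|\sum_i X i j * xi i| <= n%:R * lambda / 3) ->
  ((n%:R^-1 * l2norm (X *m (bh - betastar)) ^+ 2)%:E <=
  (n%:R^-1 * l2norm (X *m (beta - betastar)) ^+ 2)%:E +
    (lambda ^+ 2)%:E * ((mu_const X beta) ^+ 2 * (nnz beta)%:R%:E))%E.
Proof.
move=> n0 hX l0 hl noise.
(* With empty support the convention that infinity times 0 is 0 removes the mu term, so the bound is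
   needed with [k = 0]. *)
have [M0|M0] := posnP (nnz beta).
  rewrite M0 !mule0 adde0 lee_fin.
  have := @lasso_oracle n p x X xi betastar lambda 0 bh beta n0 hX (ltW l0) (lexx 0) hl noise.
  rewrite mulr0 addr0; apply => u _.
  rewrite mul0r; apply: (le_trans (sqr_l1norm_vrestr_le _ _)).
  by rewrite -/(nnz beta) M0 mul0r.
have := mu_const_ge0 X beta.
case: (mu_const X beta) (@mu_const_le n p X beta) => [r||//] hr r0; last first.
  (* Here mu is infinite and the support nonempty, so the right side is infinite. *)
  rewrite expe2 mulyy gt0_mulye ?lte_fin ?ltr0n// gt0_muley ?lte_fin ?exprn_gt0//.
  by rewrite addey// leey.
rewrite -EFin_expe -!EFinM -EFinD lee_fin; apply: (lasso_oracle n0 hX (ltW l0) _ hl noise).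
  by rewrite mulr_ge0// sqr_ge0.
move=> u hu; apply: (le_trans (sqr_l1norm_vrestr_le _ _)).
rewrite mulrAC [leRHS]mulrC ler_wpM2l//.
have -> : r ^+ 2 * (n%:R^-1 * l2norm (X *m u) ^+ 2) =
    (r * ((Num.sqrt n%:R)^-1 * l2norm (X *m u))) ^+ 2.
  by rewrite !exprMn exprVn [Num.sqrt n%:R ^+ 2]sqr_sqrtr.
have h := hr r u erefl hu.
by rewrite ler_pXn2r ?nnegrE ?sqrtr_ge0// (le_trans _ h)// sqrtr_ge0.
Qed.

End det.

(** * The noise event *)

Section event.
Context {R : realType}.

(** The exponent equals [b ^+ 2 * ln p%:R] and the prefactor is 1 / (2 b sqrt(pi log p)).
    Multiplying by 2p gives the claimed bound with an extra factor 1/b, at most 1. *)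
Lemma noise_level_bound (p n : nat) (b sigma t s : R) : (1 < p)%N -> (0 < n)%N ->
  1 <= b -> 0 < sigma ->
  t = n%:R * (b * Num.sqrt 2 * sigma * Num.sqrt (ln p%:R / n%:R)) ->
  s = sigma * Num.sqrt n%:R ->
  p%:R * (2 * (s / (t * Num.sqrt (2 * pi)) * expR (- (t ^+ 2 / (2 * s ^+ 2))))) <=
  1 / (p%:R `^ (b ^+ 2 - 1) * Num.sqrt (pi * ln p%:R)) :> R.
Proof.
move=> p1 n0 b1 s0 tE sE0.
have p0' : 0 < p%:R :> R by rewrite ltr0n (ltn_trans _ p1).
have n0' : 0 < n%:R :> R by rewrite ltr0n.
have L0 : 0 < ln p%:R :> R by rewrite ln_gt0// ltr1n.
have b0 : 0 < b by rewrite (lt_le_trans _ b1).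
have pi0 := pi_gt0 R.
have expE : t ^+ 2 / (2 * s ^+ 2) = b ^+ 2 * ln p%:R.
  rewrite tE sE0 !exprMn !sqr_sqrtr ?divr_ge0 ?ltW//.
  by field; rewrite !gt_eqF.
have sE : s / (t * Num.sqrt (2 * pi)) = (2 * b * Num.sqrt (pi * ln p%:R))^-1.
  rewrite tE sE0.
  have -> : Num.sqrt (ln p%:R / n%:R) = Num.sqrt (ln p%:R) / Num.sqrt n%:R :> R.
    by rewrite sqrtrM ?ltW// sqrtrV// ltW.
  rewrite !sqrtrM ?ltW//.
  have q1 : Num.sqrt n%:R != 0 :> R by rewrite gt_eqF// sqrtr_gt0.
  have q2 : Num.sqrt 2 != 0 :> R by rewrite gt_eqF// sqrtr_gt0.
  have q3 : Num.sqrt pi != 0 :> R by rewrite gt_eqF// sqrtr_gt0.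
  have q4 : Num.sqrt (ln p%:R) != 0 :> R by rewrite gt_eqF// sqrtr_gt0.
  (* Writing [n] and 2 as squares of their roots turns the goal into a rational identity for
     [field]. *)
  have nE : n%:R = Num.sqrt n%:R ^+ 2 :> R by rewrite sqr_sqrtr// ltW.
  have e2 : 2 = Num.sqrt 2 ^+ 2 :> R by rewrite sqr_sqrtr.
  move: (Num.sqrt n%:R) (Num.sqrt 2) (Num.sqrt pi) (Num.sqrt (ln _)) q1 q2 q3 q4 nE e2.
  move=> q1 q2 q3 q4 h1 h2 h3 h4 -> ->; field.
  by rewrite h1 h2 h3 h4 !gt_eqF.
rewrite expE sE powRB; last by rewrite (gt_eqF p0') implybT.
rewrite (powRr1 (ltW p0')) /powR (gt_eqF p0').
rewrite expRN; set e := expR _; set q := Num.sqrt _.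
have e0 : 0 < e by exact: expR_gt0.
have q0 : 0 < q by rewrite sqrtr_gt0 mulr_gt0.
have -> : p%:R * (2 * ((2 * b * q)^-1 * e^-1)) = b^-1 * (p%:R / (e * q)).
  by field; rewrite !gt_eqF.
have -> : 1 / (e / p%:R * q) = p%:R / (e * q) by field; rewrite !gt_eqF.
by rewrite ler_piMl ?invf_le1// divr_ge0 ?ltW// mulr_gt0.
Qed.

Lemma measure_bigsetU_le d (Omega : measurableType d) (P : {measure set Omega -> \bar R})
   (I : finType) (B : I -> set Omega) : (forall j, measurable (B j)) ->
   measurable (\big[setU/set0]_j B j) /\
   (P (\big[setU/set0]_j B j) <= \sum_j P (B j))%E.
Proof.
move=> mB; apply: (big_ind2 (fun S v => measurable S /\ (P S <= v)%E)) => //.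
- by rewrite measure0.
- move=> S1 v1 S2 v2 [mS1 h1] [mS2 h2]; split; first exact: measurableU.
  by apply: le_trans (measureU2 P mS1 mS2) _; exact: leeD.
Qed.

(** Union bound over the [p] coordinates: the column bound makes each standard deviation at most
    [s]. *)
Lemma noise_event (d : measure_display)
    (Omega : measurableType d) (P : probability Omega R)
    (p n : nat) (X : 'M[R]_(n, p)) (sigma t : R)
    (xi : 'I_n -> {RV P >-> R}) :
  (0 < n)%N -> 0 < sigma -> 0 < t ->
  (forall j, \sum_i X i j ^+ 2 <= n%:R) ->
  mutually_independent xi ->
  (forall (i : 'I_n) (B : set R), measurable B ->
       distribution P (xi i) B = normal_prob 0 sigma B) ->
  let s := sigma * Num.sqrt n%:R in
  let A := [set w | forall j, `|\sum_i X i j * xi i w| <= t] in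
  measurable A /\
  ((1 - p%:R * (2 * (s / (t * Num.sqrt (2 * pi)) * expR (- (t ^+ 2 / (2 * s ^+ 2))))))%:E <= P A)%E.
Proof.
move=> n0 s0 t0 hX hind hg s A.
pose T : set R := [set z : R | t < `|z|].
have mT : measurable T.
  rewrite (_ : T = Num.norm @^-1` `]t, +oo[); last first.
    by apply/seteqP; split => z /=; rewrite in_itv/= andbT.
  by rewrite -[X in measurable X]setTI; exact: normr_measurable.
pose B j : set Omega := (fun w => \sum_i X i j * xi i w) @^-1` T.
have mB j : measurable (B j).
  rewrite -[X in measurable X]setTI; exact: (measurable_lincomb xi).
have [mU PU] := measure_bigsetU_le P mB.
have AE : A = ~` \big[setU/set0]_j B j.
  rewrite -bigcup_seq setC_bigcup; apply/seteqP; split => w /= Aw j.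
    by move=> _; rewrite /B/= /T/=; apply/negP; rewrite -leNgt.
  by rewrite leNgt; apply/negP; exact: (Aw j (mem_index_enum _)).
split; first by rewrite AE; exact: measurableC.
rewrite AE probability_setC// EFinB leeB//.
apply: (le_trans PU).
set c := (X in (p%:R * X)%:E).
have -> : (p%:R * c)%:E = (\sum_(j < p) c%:E)%E.
  by rewrite sumEFin sumr_const card_ord mulr_natl.
apply: lee_sum => j _.
suff : (cgauss (Num.sqrt (\sum_i (X i j * sigma) ^+ 2)) T <= c%:E)%E.
  by rewrite -(gaussian_lincomb s0 hind hg (X^~ j) mT).
apply: cgauss_tail => //.
- have -> : s = Num.sqrt (sigma ^+ 2 * n%:R).
    by rewrite sqrtrM ?sqr_ge0// sqrtr_sqr gtr0_norm.
  have -> : \sum_i (X i j * sigma) ^+ 2 = sigma ^+ 2 * \sum_i X i j ^+ 2.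
    by rewrite mulr_sumr; apply: eq_bigr => i _; rewrite exprMn mulrC.
  by rewrite ler_wsqrtr// ler_pM2l ?exprn_gt0.
- by rewrite mulr_gt0// sqrtr_gt0 ltr0n.
Qed.
End event.

Theorem theorem14 (R : realType) (d : measure_display)
    (Omega : measurableType d) (P : probability Omega R)
    (p n : nat) (hp : (2 <= p)%N) (hn : (1 <= n)%N)
    (x : 'I_n -> 'cV[R]_p) (X : 'M[R]_(n, p)) (hX : X = \matrix_(i < n) (x i)^T)
    (hdiag : forall j : 'I_p, (n%:R^-1 *: (X^T *m X)) j j <= 1)
    (betastar : 'cV[R]_p)
    (sigma : R) (hsigma : 0 < sigma)
    (xi : 'I_n -> {RV P >-> R})
    (hindep : mutually_independent xi)
    (hgauss : forall (i : 'I_n) (B : set R), measurable B ->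
       distribution P (xi i) B = normal_prob 0 sigma B)
    (Y : 'I_n -> Omega -> R)
    (hY : forall i w, Y i w = ((x i)^T *m betastar) 0 0 + xi i w)
    (b : R) (hb : 1 <= b)
    (C : R) (hC : C = 3 * b * Num.sqrt 2)
    (lambda : R) (hlambda : lambda = C * sigma * Num.sqrt (ln p%:R / n%:R))
    (betahat : Omega -> 'cV[R]_p)
    (hlasso : forall w, is_lasso x (fun i => Y i w) lambda (betahat w)) :
  exists A : set Omega,
    [/\ measurable A,
        ((1 - 1 / (p%:R `^ (b ^+ 2 - 1) * Num.sqrt (pi * ln p%:R)))%:E <= P A)%E
      & forall w, A w ->
        ((n%:R^-1 * l2norm (X *m (betahat w - betastar)) ^+ 2)%:E <=
         ereal_inf [set (n%:R^-1 * l2norm (X *m (beta - betastar)) ^+ 2)%:E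
                     + (C ^+ 2 * sigma ^+ 2)%:E
                       * ((mu_const X beta) ^+ 2 * (nnz beta)%:R%:E
                          * (ln p%:R)%:E * (n%:R^-1)%:E)
                   | beta in [set: 'cV[R]_p]])%E].
Proof.
have n0' : 0 < n%:R :> R by rewrite ltr0n.
have b0 : 0 < b by rewrite (lt_le_trans _ hb).
have L0 : 0 < ln p%:R :> R by rewrite ln_gt0// ltr1n.
have r0 : 0 < Num.sqrt (ln p%:R / n%:R) :> R by rewrite sqrtr_gt0 divr_gt0.
have s20 : 0 < Num.sqrt 2 :> R by rewrite sqrtr_gt0.
have l0 : 0 < lambda by rewrite hlambda hC !mulr_gt0.
pose t := n%:R * (b * Num.sqrt 2 * sigma * Num.sqrt (ln p%:R / n%:R)).
(* The factor 3 in [C] cancels the third of [lambda] reserved for the noise. *)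
have tE : n%:R * lambda / 3 = t by rewrite hlambda hC /t; field.
have t0 : 0 < t by rewrite !mulr_gt0.
have colX j : \sum_i X i j ^+ 2 <= n%:R.
  have := hdiag j; rewrite !mxE mulrC ler_pdivrMr// mul1r; apply: le_trans.
  by apply: ler_sum => i _; rewrite !mxE expr2.
have [mA PA] := noise_event hn hsigma t0 colX hindep hgauss.
(* The event involves the noise only, so it serves all [beta] at once and the infimum may be taken
   on it. *)
exists [set w | forall j, `|\sum_i X i j * xi i w| <= t]; split => //.
  apply: le_trans PA; rewrite lee_fin lerB//.
  exact: (@noise_level_bound _ p n b sigma).
move=> w Aw; apply: le_ereal_inf_tmp => _ [beta _ <-].
have hl : is_lasso x (fun i => ((x i)^T *m betastar) 0 0 + xi i w) lambda (betahat w).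
  have := hlasso w; rewrite (_ : (fun i => Y i w) = fun i => ((x i)^T *m betastar) 0 0 + xi i w)//.
  by apply/funext => i; rewrite hY.
have noise j : `|\sum_i X i j * xi i w| <= n%:R * lambda / 3 by rewrite tE; exact: Aw.
apply: (le_trans (lasso_oracle_mu beta hn hX l0 hl noise)).
rewrite leeD2l//.
have -> : lambda ^+ 2 = C ^+ 2 * sigma ^+ 2 * (ln p%:R / n%:R).
  by rewrite hlambda !exprMn sqr_sqrtr// divr_ge0// ltW.
rewrite -[X in (_ <= _ * X)%E]muleA [X in (_ <= _ * X)%E]muleC muleA -!EFinM.
exact: lexx.
Qed.
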